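(* Let $n\ge1$, $\mathcal I=\{1,\dots,n\}$, and for each $i\in\mathcal I$ let $\mathcal X_i,\mathcal Y_i,\mathcal W_i$ be finite nonempty sets and $g_i:\mathcal W_i\times\mathcal X_i\to[0,1]$ a gain function. Let $\mathcal X=\mathcal X_1\times\cdots\times\mathcal X_n$, $\mathcal W=\mathcal W_1\times\cdots\times\mathcal W_n$, and let $g:\mathcal W\times\mathcal X\to[0,1]$ be a joint gain function for $g_1,\dots,g_n$. For any jointly supported prior $\pi$ on $\mathcal X$ with marginals $\pi_i$ and with $V_g(\pi)>0$, and any channels $(\mathcal X_i,\mathcal Y_i,C_i)$, $i\in\mathcal I$, $$\sum_{i\in\mathcal I}I_{g_i}(\pi_i,C_i)-\log\frac{M^{\max}_{g,\pi}}{M^{\min}_{g,\pi}}\ \le\ I_g\Bigl(\pi,\prod_{i\in\mathcal I}C_i\Bigr)\ \le\ \sum_{i\in\mathcal I}I_{g_i}(\pi_i,C_i)+\log\frac{M^{\max}_{g,\pi}}{M^{\min}_{g,\pi}}.$$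
   Context: A (discrete) channel $(\mathcal X,\mathcal Y,C)$ consists of finite sets $\mathcal X,\mathcal Y$ and a matrix $C$ with entries $C[x,y]\ge 0$ and $\sum_{y}C[x,y]=1$ for each $x$. A prior is a probability distribution. The $n$-ary parallel composition (with distinct inputs) $\prod_{i\in\mathcal I}C_i=C_1\times\cdots\times C_n$ is the channel from $\mathcal X_1\times\cdots\times\mathcal X_n$ to $\mathcal Y_1\times\cdots\times\mathcal Y_n$ whose entry at $((x_1,\dots,x_n),(y_1,\dots,y_n))$ is $\prod_{i}C_i[x_i,y_i]$. For a gain function $g:\mathcal W\times\mathcal X\to[0,1]$: $V_g(\pi)=\max_{w\in\mathcal W}\sum_{x}\pi[x]g(w,x)$, $V_g(\pi,C)=\sum_{y}\max_{w\in\mathcal W}\sum_x\pi[x]C[x,y]g(w,x)$, and the $g$-leakage is $I_g(\pi,C)=-\log V_g(\pi)+\log V_g(\pi,C)$. Logarithms are to base 2. A joint gain function $g$ for $g_1,\dots,g_n$ is required to satisfy: $g(\overline w,\overline x)=0$ if and only if $\prod_i g_i(w_i,x_i)=0$, where $\overline w=(w_1,\dots,w_n)$, $\overline x=(x_1,\dots,x_n)$ (no other relation is assumed). $\pi_i$ denotes the marginal of $\pi$ on $\mathcal X_i$. $\pi$ is jointly supported if for all $\overline x\in\mathcal X$, $\prod_i\pi_i[x_i]\neq0$ implies $\pi[\overline x]\ne0$. For $\overline w\in\mathcal W$ let $\mathcal S_{\overline w}=\{\overline x\in\mathcal X:\pi[\overline x]\,g(\overline w,\overline x)\ne0\}$.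 $M^{\min}_{g,\pi}$ (resp. $M^{\max}_{g,\pi}$) is the minimum (resp. maximum), over all $\overline w\in\mathcal W$ and $\overline x\in\mathcal S_{\overline w}$, of $$\frac{\prod_{i\in\mathcal I}\pi_i[x_i]g_i(w_i,x_i)}{\pi[\overline x]\cdot g(\overline w,\overline x)}.$$ Those $\overline w$ with $\mathcal S_{\overline w}=\emptyset$ are ignored; $V_g(\pi)>0$ guarantees that some $\mathcal S_{\overline w}$ is nonempty. *)

(* Defs.v *)
From HB Require Import structures.
From mathcomp Require Import all_boot all_order all_algebra.
From mathcomp Require Import reals exp.
Set Implicit Arguments.
Unset Strict Implicit.
Unset Printing Implicit Defensive.
Import Order.TTheory GRing.Theory Num.Theory.
Local Open Scope ring_scope.

Definition log2 (R : realType) (x : R) : R := ln x / ln 2.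

Definition is_prior (R : realType) (X : finType) (p : X -> R) : Prop :=
  (forall x, 0 <= p x) /\ \sum_x p x = 1.

(* The matrix of a channel is given by its entries [C x y]. *)
Definition is_channel (R : realType) (X Y : finType) (C : X -> Y -> R) : Prop :=
  (forall x y, 0 <= C x y) /\ (forall x, \sum_y C x y = 1).

Definition is_gain (R : realType) (W X : finType) (g : W -> X -> R) : Prop :=
  forall w x, 0 <= g w x <= 1.

(* The cartesian product of the [T i]: its elements are the tuples (x_i)_i. *)
Notation cprod T := {dffun forall i, Finite.sort (T i)}.

Definition parallel (R : realType) (n : nat) (X Y : 'I_n -> finType)
    (C : forall i, X i -> Y i -> R) (x : cprod X) (y : cprod Y) : R :=
  \prod_(i < n) C i (x i) (y i).

Definition marginal (R : realType) (n : nat) (X : 'I_n -> finType)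
    (p : cprod X -> R) (i : 'I_n) (a : X i) : R :=
  \sum_(x : cprod X | x i == a) p x.

Arguments marginal {R n X} p i a.

Definition jointly_supported (R : realType) (n : nat) (X : 'I_n -> finType)
    (p : cprod X -> R) : Prop :=
  forall x : cprod X, \prod_(i < n) marginal p i (x i) != 0 -> p x != 0.

Definition is_joint_gain (R : realType) (n : nat) (W X : 'I_n -> finType)
    (gs : forall i, W i -> X i -> R) (g : cprod W -> cprod X -> R) : Prop :=
  forall w x, g w x = 0 <-> \prod_(i < n) gs i (w i) (x i) = 0.

(* In the next two definitions the maximum is seeded with 0, which does not
   change its value: the guess set [W] is nonempty and, for priors, channels and
   gain functions, the terms are nonnegative. *)
Definition vuln (R : realType) (W X : finType) (g : W -> X -> R)
    (p : X -> R) : R :=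
  \big[Num.max/0]_(w : W) \sum_(x : X) p x * g w x.

Definition post_vuln (R : realType) (W X Y : finType) (g : W -> X -> R)
    (p : X -> R) (C : X -> Y -> R) : R :=
  \sum_(y : Y) \big[Num.max/0]_(w : W) \sum_(x : X) p x * C x y * g w x.

Definition leakage (R : realType) (W X Y : finType) (g : W -> X -> R)
    (p : X -> R) (C : X -> Y -> R) : R :=
  - log2 (vuln g p) + log2 (post_vuln g p C).

Definition gain_support (R : realType) (W X : finType) (g : W -> X -> R)
    (p : X -> R) (w : W) : {set X} :=
  [set x | p x * g w x != 0].

Definition ratios (R : realType) (n : nat) (W X : 'I_n -> finType)
    (gs : forall i, W i -> X i -> R) (g : cprod W -> cprod X -> R)
    (p : cprod X -> R) : seq R :=
  [seq (\prod_(i < n) (marginal p i (x i) * gs i (w i) (x i))) / (p x * g w x)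
  | w : cprod W <- enum (cprod W), x : cprod X <- enum (gain_support g p w)].

(* Minimum and maximum of a nonempty sequence (0 on the empty one): the head
   serves as initial value, so that no foreign element enters the comparison. *)
Definition seq_min (R : realType) (s : seq R) : R :=
  \big[Num.min/head 0 s]_(r <- s) r.

Definition seq_max (R : realType) (s : seq R) : R :=
  \big[Num.max/head 0 s]_(r <- s) r.

Definition Mmin (R : realType) (n : nat) (W X : 'I_n -> finType)
    (gs : forall i, W i -> X i -> R) (g : cprod W -> cprod X -> R)
    (p : cprod X -> R) : R :=
  seq_min (ratios gs g p).

Definition Mmax (R : realType) (n : nat) (W X : 'I_n -> finType)
    (gs : forall i, W i -> X i -> R) (g : cprod W -> cprod X -> R)
    (p : cprod X -> R) : R :=
  seq_max (ratios gs g p).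

(* Main.v *)
(** Since [p] is jointly supported and [g] vanishes exactly where the product
    of the [g_i] does, the inequalities
      [Mmin * p x * g w x <= \prod_i p_i x_i * g_i w_i x_i <= Mmax * p x * g w x]
    hold at every [(w, x)], also where both sides are 0. They pass through the
    sums and maxima defining prior and posterior vulnerability, and both
    vulnerabilities are multiplicative for the product prior, the product gain
    function and the parallel channel. It remains to take logarithms. *)
Require Import Defs.
From HB Require Import structures.
From mathcomp Require Import all_boot all_order all_algebra.
From mathcomp Require Import reals exp lra.
Set Implicit Arguments.
Unset Strict Implicit.
Unset Printing Implicit Defensive.
Import Order.TTheory GRing.Theory Num.Theory.
Local Open Scope ring_scope.

(** Distributivity for a dependent family [T]: the sums are moved to the tagged union of the [T i],
    where the non-dependent law applies, and the resulting choice functions are reindexed by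
    [cprod T]. *)
Lemma prod_sum_dffun (R : comNzRingType) (I : finType) (T : I -> finType)
    (F : forall i, T i -> R) :
  \prod_(i : I) \sum_(a : T i) F i a =
  \sum_(x : cprod T) \prod_(i : I) F i (x i).
Proof.
(* The summands are recast as finite functions, the form in which [big_fprod] takes them. *)
have untag_finfun i u :
    @untag I T R 0 i (F i) u = @untag I T R 0 i [ffun a => F i a] u.
  by rewrite /untag; case: eqP => // e; rewrite ffunE.
under eq_bigr do rewrite (big_tag F).
rewrite bigA_distr_big_dep.
under eq_bigr do under eq_bigr do rewrite untag_finfun.
rewrite -big_fprod (reindex (@fprod_of_dffun _ T)); last first.
  exact/onW_bij/fprod_of_dffun_bij.
apply: eq_bigr => x _; apply: eq_bigr => i _.
by rewrite ffunE fprodE.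
Qed.

(** Coordinates are chosen independently, so maximizers of the single factors assemble into one of
    the product. *)
Lemma prod_bigmax_dffun (R : realDomainType) (I : finType) (T : I -> finType)
    (F : forall i, T i -> R) :
  (forall i, 0 < #|T i|)%N -> (forall i a, 0 <= F i a) ->
  \prod_(i : I) \big[Num.max/0]_(a : T i) F i a =
  \big[Num.max/0]_(x : cprod T) \prod_(i : I) F i (x i).
Proof.
move=> T_gt0 F_ge0; apply/eqP; rewrite eq_le; apply/andP; split; last first.
  apply: bigmax_le => [|x _].
    by apply: prodr_ge0 => i _; exact: bigmax_ge_id.
  by apply: ler_prod => i _; rewrite F_ge0 le_bigmax.
(* As [T i] is nonempty and [F i] nonnegative, the maximum is a value of [F i] and not merely the
   seed 0. *)
have argmax i : {a | \big[Num.max/0]_(b : T i) F i b = F i a}.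
  have /card_gt0P/sigW[a0 _] := T_gt0 i.
  have [a _ ->] := eq_bigmax a0 predT (F i) isT (fun b _ => F_ge0 i b).
  by exists a.
pose w : cprod T := [ffun i => sval (argmax i)].
apply: (bigmax_sup w) => //; rewrite le_eqVlt; apply/orP; left.
apply/eqP/eq_bigr => i _.
by rewrite ffunE; case: (argmax i).
Qed.

(** Prior and gain enter only through their product. The weights [p] and [p'] are arbitrary
    functions so that unnormalised columns of a joint matrix are covered too. *)
Lemma vuln_le (R : realType) (W X : finType) (g g' : W -> X -> R)
    (p p' : X -> R) (c : R) :
  0 <= c -> (forall w x, p x * g w x <= c * (p' x * g' w x)) ->
  vuln g p <= c * vuln g' p'.
Proof.
move=> c_ge0 le_g; apply: bigmax_le => [|w _].
  by rewrite mulr_ge0 // bigmax_ge_id.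
apply: (@le_trans _ _ (c * \sum_x p' x * g' w x)).
  by rewrite mulr_sumr; apply: ler_sum.
by apply: ler_wpM2l => //; apply: (le_bigmax 0 (fun v => \sum_x p' x * g' v x)).
Qed.

Lemma post_vuln_le (R : realType) (W X Y : finType) (g g' : W -> X -> R)
    (p p' : X -> R) (C : X -> Y -> R) (c : R) :
  0 <= c -> (forall x y, 0 <= C x y) ->
  (forall w x, p x * g w x <= c * (p' x * g' w x)) ->
  post_vuln g p C <= c * post_vuln g' p' C.
Proof.
move=> c_ge0 C_ge0 le_g; rewrite mulr_sumr; apply: ler_sum => y _.
(* For fixed [y] the posterior summand is the vulnerability of the column [p x * C x y]. *)
apply: (@vuln_le _ _ _ g g' (fun x => p x * C x y) (fun x => p' x * C x y)) => //.
move=> w x; rewrite ![_ * C x y * _]mulrAC mulrA.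
exact: ler_wpM2r.
Qed.

(** Rows of [C] sum to 1, and a maximum of sums is at most the sum of the maxima. This later makes
    the posterior vulnerabilities positive. *)
Lemma vuln_le_post_vuln (R : realType) (W X Y : finType) (g : W -> X -> R)
    (p : X -> R) (C : X -> Y -> R) :
  is_channel C -> vuln g p <= post_vuln g p C.
Proof.
move=> [_ C_sum1]; apply: bigmax_le => [|w _].
  by apply: sumr_ge0 => y _; exact: bigmax_ge_id.
have -> : \sum_x p x * g w x = \sum_y \sum_x p x * C x y * g w x.
  rewrite exchange_big; apply: eq_bigr => x _.
  by under eq_bigr do rewrite mulrAC; rewrite -mulr_sumr C_sum1 mulr1.
by apply: ler_sum => y _;
  apply: (le_bigmax 0 (fun v => \sum_x p x * C x y * g v x)).
Qed.

Lemma vuln_prod (R : realType) (n : nat) (W X : 'I_n -> finType)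
    (gs : forall i, W i -> X i -> R) (ps : forall i, X i -> R) :
  (forall i, 0 < #|W i|)%N -> (forall i w a, 0 <= gs i w a) ->
  (forall i a, 0 <= ps i a) ->
  vuln (fun w : cprod W => fun x : cprod X => \prod_(i < n) gs i (w i) (x i))
       (fun x : cprod X => \prod_(i < n) ps i (x i)) =
  \prod_(i < n) vuln (gs i) (ps i).
Proof.
move=> W_gt0 gs_ge0 ps_ge0.
rewrite (prod_bigmax_dffun (F := fun i v => \sum_a ps i a * gs i v a)) //.
  apply: eq_bigr => w _.
  rewrite (prod_sum_dffun (fun i a => ps i a * gs i (w i) a)).
  by apply: eq_bigr => x _; rewrite big_split.
by move=> i v; apply: sumr_ge0 => a _; exact: mulr_ge0.
Qed.

Lemma post_vuln_prod (R : realType) (n : nat) (W X Y : 'I_n -> finType)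
    (gs : forall i, W i -> X i -> R) (ps : forall i, X i -> R)
    (C : forall i, X i -> Y i -> R) :
  (forall i, 0 < #|W i|)%N -> (forall i w a, 0 <= gs i w a) ->
  (forall i a, 0 <= ps i a) -> (forall i a b, 0 <= C i a b) ->
  post_vuln (fun w : cprod W => fun x : cprod X => \prod_(i < n) gs i (w i) (x i))
            (fun x : cprod X => \prod_(i < n) ps i (x i)) (parallel C) =
  \prod_(i < n) post_vuln (gs i) (ps i) (C i).
Proof.
move=> W_gt0 gs_ge0 ps_ge0 C_ge0.
rewrite prod_sum_dffun; apply: eq_bigr => y _.
(* For fixed [y] the column of the parallel channel is again a product of weights, one per
   component. *)
rewrite -(@vuln_prod _ _ _ _ gs (fun i a => ps i a * C i a (y i))) //; last first.
  by move=> i a; exact: mulr_ge0.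
by apply: eq_bigr => w _; apply: eq_bigr => x _; rewrite /parallel big_split.
Qed.

Lemma seq_min_le (R : realType) (s : seq R) r : r \in s -> seq_min s <= r.
Proof. by move=> rs; exact: (ge_bigmin_seq _ r predT id). Qed.

Lemma le_seq_max (R : realType) (s : seq R) r : r \in s -> r <= seq_max s.
Proof. by move=> rs; exact: (le_bigmax_seq _ r predT id). Qed.

Lemma seq_min_in (R : realType) (s : seq R) : s != [::] -> seq_min s \in s.
Proof.
case: s => // r0 s _; rewrite /seq_min /=.
rewrite big_seq; apply: (big_ind (fun r => r \in r0 :: s)) => //.
  exact: mem_head.
by move=> a b a_s b_s; rewrite /Order.min; case: ifP.
Qed.

Lemma log2M (R : realType) (x y : R) :
  0 < x -> 0 < y -> log2 (x * y) = log2 x + log2 y.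
Proof. by move=> x_gt0 y_gt0; rewrite /log2 lnM ?posrE // mulrDl. Qed.

Lemma log2_div (R : realType) (x y : R) :
  0 < x -> 0 < y -> log2 (x / y) = log2 x - log2 y.
Proof. by move=> x_gt0 y_gt0; rewrite /log2 ln_div ?posrE // mulrBl. Qed.

Lemma log2_prod (R : realType) (I : finType) (F : I -> R) :
  (forall i, 0 < F i) -> log2 (\prod_i F i) = \sum_i log2 (F i).
Proof.
move=> F_gt0.
(* Positivity is carried through the induction because [log2M] requires it of both factors. *)
suff [] : 0 < \prod_i F i /\ log2 (\prod_i F i) = \sum_i log2 (F i) by [].
apply: (big_ind2 (fun a b => 0 < a /\ log2 a = b)) => //.
  by rewrite /log2 ln1 mul0r.
move=> a b c d [a_gt0 <-] [c_gt0 <-].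
by rewrite mulr_gt0 // log2M.
Qed.

Lemma ler_log2 (R : realType) (x y : R) : 0 < x -> x <= y -> log2 x <= log2 y.
Proof.
move=> x_gt0 le_xy; apply: ler_wpM2r.
  by rewrite invr_ge0 ln_ge0 // ler1n.
by rewrite ler_ln // posrE // (lt_le_trans x_gt0).
Qed.

Section Ratios.
Variables (R : realType) (n : nat) (W X : 'I_n -> finType).
Variables (gs : forall i, W i -> X i -> R) (g : cprod W -> cprod X -> R).
Variable p : cprod X -> R.
Hypothesis gs_ge0 : forall i (w : W i) a, 0 <= gs w a.
Hypothesis g_ge0 : forall w x, 0 <= g w x.
Hypothesis g_joint : is_joint_gain gs g.
Hypothesis p_ge0 : forall x, 0 <= p x.

Local Notation jointT w x := (p x * g w x).
Local Notation prodT w x :=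
  (\prod_(i < n) (marginal p i (x i) * gs (w i) (x i))).

Lemma marginal_ge0 i a : 0 <= marginal p i a.
Proof. by apply: sumr_ge0. Qed.

Lemma le_marginal (x : cprod X) i : p x <= marginal p i (x i).
Proof. by rewrite /marginal (bigD1 x) //= lerDl sumr_ge0. Qed.

(** Each marginal dominates [p x], and a vanishing [gs] factor would force [g w x = 0]. *)
Lemma prod_term_gt0 w x : jointT w x != 0 -> 0 < prodT w x.
Proof.
rewrite mulf_eq0 negb_or => /andP[px_neq0 gwx_neq0].
have px_gt0 : 0 < p x by rewrite lt_def px_neq0 p_ge0.
apply: prodr_gt0 => i _; apply: mulr_gt0.
  exact: lt_le_trans px_gt0 (le_marginal x i).
rewrite lt_def gs_ge0 andbT; apply: contra_neq gwx_neq0 => gs0.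
by apply/g_joint; rewrite (bigD1 i) //= gs0 mul0r.
Qed.

Lemma ratios_gt0 r : r \in ratios gs g p -> 0 < r.
Proof.
case/allpairsPdep=> w [x [_ + ->]]; rewrite mem_enum inE => jointT_neq0.
by rewrite divr_gt0 ?prod_term_gt0 // lt_def jointT_neq0 mulr_ge0.
Qed.

Lemma mem_ratios w x :
  jointT w x != 0 -> prodT w x / jointT w x \in ratios gs g p.
Proof.
by move=> jointT_neq0; apply/allpairsPdep; exists w, x; split;
  rewrite ?mem_enum ?inE.
Qed.

Lemma ratios_neq0 : 0 < vuln g p -> ratios gs g p != [::].
Proof.
move=> V_gt0; apply: (contraTneq _ V_gt0) => ratios0; rewrite -leNgt.
apply: bigmax_le => // w _; rewrite big1 // => x _.
apply/eqP; apply: contraT => /mem_ratios.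
by rewrite ratios0.
Qed.

Lemma Mmin_gt0 : 0 < vuln g p -> 0 < Mmin gs g p.
Proof. by move=> /ratios_neq0/seq_min_in/ratios_gt0. Qed.

Lemma Mmin_le_Mmax : 0 < vuln g p -> Mmin gs g p <= Mmax gs g p.
Proof. by move=> /ratios_neq0/seq_min_in/le_seq_max. Qed.

Hypothesis p_joint : jointly_supported p.

(** Covers the points outside the range of [ratios]: joint support handles [p x = 0], the joint gain
    condition handles [g w x = 0]. *)
Lemma prod_term_eq0 w x : jointT w x = 0 -> prodT w x = 0.
Proof.
move=> /eqP; rewrite big_split mulf_eq0 /= => /orP[/eqP px0|/eqP/g_joint ->].
  have [-> |/p_joint] := eqVneq (\prod_(i < n) marginal p i (x i)) 0.
    by rewrite mul0r.
  by rewrite px0 eqxx.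
by rewrite mulr0.
Qed.

Lemma prod_term_bounds w x :
  Mmin gs g p * jointT w x <= prodT w x <= Mmax gs g p * jointT w x.
Proof.
have [j0|j_neq0] := eqVneq (jointT w x) 0.
  by rewrite prod_term_eq0 // j0 !mulr0 lexx.
have j_gt0 : 0 < jointT w x by rewrite lt_def j_neq0 mulr_ge0.
rewrite -(ler_pdivlMr _ _ j_gt0) -(ler_pdivrMr _ _ j_gt0).
by rewrite /Mmin /Mmax seq_min_le ?le_seq_max // mem_ratios.
Qed.

End Ratios.

Theorem proposition3p17 (R : realType) (n : nat) (X Y W : 'I_n -> finType)
    (gs : forall i, W i -> X i -> R) (g : cprod W -> cprod X -> R)
    (p : cprod X -> R) (C : forall i, X i -> Y i -> R) :
  (1 <= n)%N ->
  (forall i, 0 < #|X i|)%N ->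
  (forall i, 0 < #|Y i|)%N ->
  (forall i, 0 < #|W i|)%N ->
  (forall i, is_gain (gs i)) ->
  is_gain g ->
  is_joint_gain gs g ->
  is_prior p ->
  jointly_supported p ->
  0 < vuln g p ->
  (forall i, is_channel (C i)) ->
  \sum_(i < n) leakage (gs i) (marginal p i) (C i)
      - log2 (Mmax gs g p / Mmin gs g p)
    <= leakage g p (parallel C)
    <= \sum_(i < n) leakage (gs i) (marginal p i) (C i)
      + log2 (Mmax gs g p / Mmin gs g p).
Proof.
move=> _ _ _ W_gt0 gs_gain g_gain g_joint [p_ge0 _] p_joint V_gt0 C_chan.
have gs_ge0 i w a : 0 <= gs i w a by case/andP: (gs_gain i w a).
have g_ge0 w x : 0 <= g w x by case/andP: (g_gain w x).
have C_ge0 i a b : 0 <= C i a b by case: (C_chan i).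
have m_ge0 i a : 0 <= marginal p i a by exact: marginal_ge0.
have parC_ge0 x y : 0 <= parallel C x y by exact: prodr_ge0.
have bounds := prod_term_bounds g_ge0 g_joint p_ge0 p_joint.
have m_gt0 := Mmin_gt0 gs_ge0 g_ge0 g_joint p_ge0 V_gt0.
have M_gt0 : 0 < Mmax gs g p.
  exact: lt_le_trans m_gt0 (Mmin_le_Mmax gs V_gt0).
set m := Mmin gs g p in bounds m_gt0 *; set M := Mmax gs g p in bounds M_gt0 *.
(* Marginals and gains are split into two products, the shape of prior and gain in [vuln_prod]. *)
have lower (w : cprod W) (x : cprod X) : p x * g w x <=
    m^-1 * (\prod_i marginal p i (x i) * \prod_i gs i (w i) (x i)).
  by rewrite -big_split /= ler_pdivlMl //; case/andP: (bounds w x).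
have upper (w : cprod W) (x : cprod X) :
    \prod_i marginal p i (x i) * \prod_i gs i (w i) (x i) <=
    M * (p x * g w x).
  by rewrite -big_split /=; case/andP: (bounds w x).
have mV_ge0 : 0 <= m^-1 by rewrite invr_ge0 ltW.
have prior_lower := vuln_le mV_ge0 lower.
have prior_upper := vuln_le (ltW M_gt0) upper.
have post_lower := post_vuln_le mV_ge0 parC_ge0 lower.
have post_upper := post_vuln_le (ltW M_gt0) parC_ge0 upper.
rewrite vuln_prod // ler_pdivlMl // in prior_lower.
rewrite vuln_prod // in prior_upper.
rewrite post_vuln_prod // ler_pdivlMl // in post_lower.
rewrite post_vuln_prod // in post_upper.
(* The product of these vulnerabilities is at least [m * vuln g p > 0], so no factor vanishes. *)
have Vs_gt0 i : 0 < vuln (gs i) (marginal p i).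
  rewrite lt_def bigmax_ge_id andbT.
  apply: contraTneq (lt_le_trans (mulr_gt0 m_gt0 V_gt0) prior_lower) => Vi0.
  by rewrite (bigD1 i) //= Vi0 mul0r ltxx.
have posts_gt0 i : 0 < post_vuln (gs i) (marginal p i) (C i).
  exact: lt_le_trans (Vs_gt0 i) (vuln_le_post_vuln _ _ (C_chan i)).
have prodV_gt0 := prodr_gt0 (index_enum 'I_n) (fun i (_ : true) => Vs_gt0 i).
have prodpost_gt0 := prodr_gt0 (index_enum 'I_n) (fun i (_ : true) => posts_gt0 i).
have post_gt0 : 0 < post_vuln g p (parallel C).
  by have := lt_le_trans prodpost_gt0 post_upper; rewrite pmulr_rgt0.
rewrite /leakage big_split sumrN /= -!log2_prod // log2_div //.
(* The left inequality combines [prior_lower] with [post_upper], the right one [prior_upper] with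
   [post_lower]; each pair costs one [log2 M - log2 m]. *)
have := ler_log2 (mulr_gt0 m_gt0 V_gt0) prior_lower.
have := ler_log2 prodV_gt0 prior_upper.
have := ler_log2 (mulr_gt0 m_gt0 post_gt0) post_lower.
have := ler_log2 prodpost_gt0 post_upper.
rewrite !log2M // => ? ? ? ?.
by apply/andP; split; lra.
Qed.
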